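(* For all integers $\alpha,n\ge0$, $$p_{5,5}\left(2 \cdot 5^{2 \alpha+1} n+\frac{31 \cdot 5^{2 \alpha}-7}{12}\right) \equiv 0 \pmod 2,\qquad p_{5,5}\left(2 \cdot 5^{2 \alpha+1} n+\frac{79 \cdot 5^{2 \alpha}-7}{12}\right) \equiv 0 \pmod 2,$$ $$p_{5,5}\left(2 \cdot 5^{2 \alpha+2} n+\frac{83 \cdot 5^{2 \alpha+1}-7}{12}\right) \equiv 0 \pmod 2,\qquad p_{5,5}\left(2 \cdot 5^{2 \alpha+2} n+\frac{107 \cdot 5^{2 \alpha+1}-7}{12}\right) \equiv 0 \pmod 2.$$
   Context: For a partition $\lambda$, $\mathrm{mex}_{5,5}(\lambda)$ is the smallest positive multiple of $5$ that is not a part of $\lambda$; $p_{5,5}(n)$ is the number of partitions $\lambda$ of $n$ with $\mathrm{mex}_{5,5}(\lambda)\equiv 5 \pmod{10}$. *)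

(* Defs.v *)
From mathcomp Require Import all_boot.

Set Implicit Arguments.
Unset Strict Implicit.
Unset Printing Implicit Defensive.

Definition is_partition (n : nat) (s : seq nat) : bool :=
  [&& sorted geq s, all (leq 1) s & sumn s == n].

Lemma leq_sumn_mem (s : seq nat) (k : nat) : k \in s -> k <= sumn s.
Proof.
elim: s => //= x s IH; rewrite in_cons => /orP[/eqP-> | /IH h].
  exact: leq_addr.
exact: leq_trans h (leq_addl _ _).
Qed.

Lemma mex55_exists (s : seq nat) :
  exists k, [&& 0 < k, 5 %| k & k \notin s].
Proof.
exists (5 * (sumn s).+1); rewrite muln_gt0 dvdn_mulr //=.
apply/negP => /leq_sumn_mem; apply/negP; rewrite -ltnNge.
by rewrite -[X in X <= _]mul1n leq_mul2r orbT.
Qed.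

Definition mex55 (s : seq nat) : nat := ex_minn (mex55_exists s).

(* A partition of n has at most n parts, each at most n, so the partitions of n
   all live in the finite type of sequences over 'I_n.+1 of length at most n;
   p55E below shows that nothing is missed. *)
Definition p55 (n : nat) : nat :=
  #|[set t : {bseq n of 'I_n.+1} |
      let s := map val t in
      is_partition n s && (mex55 s == 5 %[mod 10])]|.

Lemma size_leq_sumn (s : seq nat) : all (leq 1) s -> size s <= sumn s.
Proof.
elim: s => //= x s IH /andP[x0 /IH h].
by rewrite -add1n leq_add.
Qed.

Lemma p55E (n : nat) (ps : seq (seq nat)) :
  uniq ps -> (forall s, (s \in ps) = is_partition n s) ->
  p55 n = count (fun s => mex55 s == 5 %[mod 10]) ps.
Proof.
move=> ups mps; rewrite /p55 cardE -size_filter.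
set A := [set _ | _].
rewrite -(size_map (fun t : {bseq n of 'I_n.+1} => map val t)).
apply/perm_size/uniq_perm.
- rewrite map_inj_uniq ?enum_uniq // => t u /(inj_map val_inj) h.
  exact: val_inj.
- exact: filter_uniq.
move=> s; rewrite mem_filter mps; apply/mapP/andP => [[t] | [hm hs]].
  by rewrite mem_enum inE => /andP[h1 h2] ->.
have /and3P[_ pos /eqP sn] := hs.
have lt_s : all (fun k => k < n.+1) s.
  by apply/allP => k /leq_sumn_mem; rewrite sn ltnS.
have es : map val (map (@inord n) s) = s.
  rewrite -map_comp -[RHS]map_id; apply/eq_in_map => k /(allP lt_s) h /=.
  by rewrite inordK.
have sz : size (map (@inord n) s) <= n.
  by rewrite size_map -[X in _ <= X]sn size_leq_sumn.
by exists (Bseq sz); rewrite ?mem_enum ?inE /= es ?hs ?hm.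
Qed.

(* Main.v *)
(** Write f_c for the sum of q^(c k(3k-1)/2) over all integers k and psi_c for
    the sum of q^(c j(j+1)/2) over j >= 0.  Modulo 2 the generating function of
    p55 is psi_5 / f_1, because the number of j such that 5, 10, ..., 5j are all
    parts of a partition has the parity of mex/5, and 1 / f_1 generates the
    partitions (Euler's pentagonal number theorem, proved through a finite
    identity of Shanks).  Two congruences modulo 2,
      f_c f_2c = psi_c   and   f_1 f_5 = psi_2 + q psi_10,
    follow by counting, with parity, the solutions of u^2 + d v^2 = M for d = 2
    and d = 5.  Since squaring doubles exponents modulo 2, they give
      psi_5 / f_1 = (f_5 f_2)^2 + q (f_5 psi_5 / f_1)^2.
    Hence p55(2n) is odd only if n = 5 pent(k) + 2 pent(l) for some k and l, which
    makes 24n + 7 of the form 2x^2 + 5y^2; the four progressions are excluded by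
    descent modulo 25 and the quadratic residues modulo 5. *)

Require Import Defs.
From mathcomp Require Import all_boot all_algebra zify ring.

Set Implicit Arguments.
Unset Strict Implicit.
Unset Printing Implicit Defensive.

Import GRing.Theory.

(** * Counting by bijections, and modulo 2 by involutions *)

Lemma count_bij (T U : eqType) (s : seq T) (t : seq U) (P : pred T)
    (Q : pred U) (f : T -> U) (g : U -> T) :
  uniq s -> uniq t ->
  (forall x, x \in s -> P x -> [/\ f x \in t, Q (f x) & g (f x) = x]) ->
  (forall y, y \in t -> Q y -> [/\ g y \in s, P (g y) & f (g y) = y]) ->
  count P s = count Q t.
Proof.
move=> us ut fP gQ; rewrite -!size_filter -(size_map f).
apply/perm_size/uniq_perm; last 1 first.
- move=> y; rewrite mem_filter; apply/mapP/andP => [[x] | [Qy ty]].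
    by rewrite mem_filter => /andP[Px sx] ->; case: (fP x sx Px).
  by case: (gQ y ty Qy) => sg Pg fg; exists (g y); rewrite // mem_filter Pg.
- rewrite map_inj_in_uniq ?filter_uniq // => x y.
  rewrite !mem_filter => /andP[Px sx] /andP[Py sy] e.
  by have [_ _ <-] := fP x sx Px; have [_ _ <-] := fP y sy Py; rewrite e.
- exact: filter_uniq.
Qed.

(** Points that are not fixed pair off as [x], [f x]; the induction strips one fixed point or one
    such pair at a time. *)
Lemma odd_size_invol (T : eqType) (f : T -> T) (s : seq T) :
  uniq s -> (forall x, x \in s -> f x \in s /\ f (f x) = x) ->
  odd (size s) = odd (count (fun x => f x == x) s).
Proof.
have [n] := ubnP (size s); elim: n s => // n IH [//|x s] /= lt_s /andP[xs us] fs.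
have [fx ffx] := fs x (mem_head _ _).
have [e | ne] := eqVneq (f x) x.
  rewrite /= IH // => y sy.
  have [] := fs y (mem_behead (s := x :: s) sy); rewrite inE => /orP[/eqP fy | //] ffy.
  by move: xs; rewrite -[x in x \notin s]e -fy ffy sy.
move: fx; rewrite inE (negPf ne) /= => sfx.
have /perm_to_rem pr := sfx.
have sz := perm_size pr; have /permP -> := pr.
rewrite /= ffx eq_sym (negPf ne) /= !add0n sz /= negbK.
have ur : uniq (rem (f x) s) by exact: rem_uniq.
apply: IH => //; first by rewrite sz /= in lt_s; lia.
move=> y; rewrite mem_rem_uniq // inE /= => /andP[nyf sy].
have [] := fs y (mem_behead (s := x :: s) sy); rewrite inE => /orP[/eqP fy | sfy] ffy.
  by move: nyf; rewrite -fy ffy eqxx.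
split=> //; rewrite mem_rem_uniq // inE /= sfy andbT.
by apply: contraNneq xs => e; have := ffy; rewrite e ffx => ->.
Qed.

Lemma odd_count_invol (T : eqType) (f : T -> T) (s : seq T) (P : pred T) :
  uniq s ->
  (forall x, x \in s -> P x -> [/\ f x \in s, P (f x) & f (f x) = x]) ->
  odd (count P s) = odd (count (fun x => P x && (f x == x)) s).
Proof.
move=> us fP; rewrite -size_filter (@odd_size_invol _ f) ?filter_uniq //.
  by rewrite count_filter; congr odd; apply: eq_count => x /=; rewrite andbC.
by move=> x; rewrite !mem_filter => /andP[Px sx]; have [-> -> ->] := fP x sx Px.
Qed.

Local Open Scope ring_scope.

(** * Parity of the number of representations of M by u^2 + d v^2 *)

Definition zseq (B : nat) : seq int :=
  [seq i%:Z - B%:Z | i <- iota 0 (2 * B).+1].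

Lemma mem_zseq B x : (x \in zseq B) = (`|x| <= B)%N.
Proof.
apply/mapP/idP => [[i] | h]; first by rewrite mem_iota => h ->; lia.
by exists (absz (x + B%:Z)); rewrite ?mem_iota; lia.
Qed.

Lemma zseq_uniq B : uniq (zseq B).
Proof. by rewrite map_inj_uniq ?iota_uniq // => i j; lia. Qed.

Definition box (B : nat) : seq (int * int) :=
  [seq (x, y) | x <- zseq B, y <- zseq B].

Lemma mem_box B p : (p \in box B) = (`|p.1| <= B)%N && (`|p.2| <= B)%N.
Proof.
apply/allpairsP/andP => [[[x y] [/=]] | [px py]].
  by rewrite !mem_zseq => hx hy ->.
by exists p; rewrite !mem_zseq; case: p px py.
Qed.

Lemma box_uniq B : uniq (box B).
Proof. by apply: allpairs_uniq; rewrite ?zseq_uniq // => -[? ?] [? ?]. Qed.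

(* For d = 2, 5, the substitution x = u - d v, y = u + v turns
   x^2 + d y^2 = (1 + d) M with x, y = -1 mod 6 into u^2 + d v^2 = M; the
   condition on x and y becomes u + v = 2 mod 3 when M has the right residue. *)
Definition rep_pred (d M : nat) : pred (int * int) :=
  fun p => (p.1 ^+ 2 + d%:Z * p.2 ^+ 2 == M%:Z) && ((p.1 + p.2) %% 3 == 2)%Z.

Definition rep_count (d M : nat) : nat := count (rep_pred d M) (box M).

Definition is_sqmul (d M : nat) : bool :=
  has (fun k => d * k ^ 2 == M)%N (iota 0 M.+1).

Lemma is_sqmulP d M : (0 < d)%N ->
  reflect (exists k, d * k ^ 2 = M)%N (is_sqmul d M).
Proof.
move=> d0; apply: (iffP hasP) => [[k _ /eqP <-] | [k h]]; first by exists k.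
by exists k; rewrite ?h // mem_iota /=; nia.
Qed.

Lemma rep_pred_box d M p : (0 < d)%N ->
  p.1 ^+ 2 + d%:Z * p.2 ^+ 2 = M%:Z -> p \in box M.
Proof. by case: p => u v /= d0 e; rewrite mem_box /=; nia. Qed.

Lemma odd_count1 (T : eqType) (s : seq T) (P : pred T) x0 :
  uniq s -> x0 \in s -> (forall x, P x = (x == x0)) -> odd (count P s).
Proof. by move=> us sx eP; rewrite (eq_count eP) count_uniq_mem // sx. Qed.

Lemma sqr_mod3 (u : int) : (u ^+ 2 %% 3)%Z = ((u %% 3)%Z != 0).
Proof.
have [a [] [] e] : exists a, u = 3 * a \/ u = 3 * a + 1 \/ u = 3 * a + 2.
  by exists (u %/ 3)%Z; lia.
- have -> : u ^+ 2 = 3 * (3 * a ^+ 2) by rewrite e; ring.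
  lia.
- have -> : u ^+ 2 = 3 * (3 * a ^+ 2 + 2 * a) + 1 by rewrite e; ring.
  lia.
- have -> : u ^+ 2 = 3 * (3 * a ^+ 2 + 4 * a + 1) + 1 by rewrite e; ring.
  lia.
Qed.

(** Modulo 3 the form is u^2 - v^2, and a square is the indicator of not being divisible by 3. *)
Lemma rep_form_mod3 d M (u v : int) : (d %% 3 = 2)%N ->
  u ^+ 2 + d%:Z * v ^+ 2 = M%:Z ->
  (M %% 3 + ((v %% 3)%Z != 0) = ((u %% 3)%Z != 0) %[mod 3])%N.
Proof.
move=> d3 e; have := sqr_mod3 u; have := sqr_mod3 v.
have [d' ed] : exists d' : nat, d%:Z = 3 * d'%:Z + 2 by exists (d %/ 3)%N; lia.
have : u ^+ 2 + 2 * v ^+ 2 + 3 * (d'%:Z * v ^+ 2) = M%:Z by rewrite -e ed; ring.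
by move: (u ^+ 2) (v ^+ 2) (d'%:Z * _) => U V W; lia.
Qed.

(** Exactly one coordinate is divisible by 3: [v] if M is 1 modulo 3, [u] if M is 2. Negating that
    coordinate keeps u + v modulo 3, so it is an involution, and its fixed points have that
    coordinate zero. *)
Lemma odd_rep_count_ndvd3 d M : (d %% 3 = 2)%N -> (M %% 3 != 0)%N ->
  odd (rep_count d M) = is_sqmul 1 M (+) is_sqmul d M.
Proof.
move=> d3 M3; have d0 : (0 < d)%N by lia.
have sq_mod (k : nat) : (d * k ^ 2 == M)%N -> (M %% 3 = 2)%N.
  move=> /eqP e; have := @rep_form_mod3 d M 0 k%:Z d3; rewrite -e; lia.
have sq1_mod (k : nat) : (1 * k ^ 2 == M)%N -> (M %% 3 = 1)%N.
  move=> /eqP e; have := @rep_form_mod3 d M k%:Z 0 d3; rewrite -e; lia.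
have [M1 | M2] : (M %% 3 = 1)%N \/ (M %% 3 = 2)%N by lia.
- have -> : is_sqmul d M = false.
    by apply/negP => /(is_sqmulP _ d0)[k /eqP/sq_mod]; lia.
  rewrite addbF /rep_count (@odd_count_invol _ (fun p => (p.1, - p.2))) ?box_uniq //; last first.
    move=> [u v] _ /andP[/eqP /= e c]; have m := rep_form_mod3 d3 e.
    split; [|apply/andP; split => /=|by rewrite /= opprK].
    + by apply: (@rep_pred_box d) => //=; rewrite sqrrN.
    + by rewrite sqrrN e.
    + lia.
  case: (boolP (is_sqmul 1 M)) => [/(is_sqmulP _ (ltn0Sn 0))[k ek] | nsq].
    have := @rep_form_mod3 d M k%:Z 0 d3 => /(_ ltac:(lia)) m.
    (* The congruence on u + v keeps exactly one of the two roots k and -k. *)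
    have [u [eu u3]] : exists u : int, u ^+ 2 = k%:Z ^+ 2 /\ (u %% 3)%Z = 2.
      have [k1|k2] : (k %% 3 = 1)%N \/ (k %% 3 = 2)%N by lia.
        by exists (- k%:Z); rewrite sqrrN; lia.
      by exists k%:Z; lia.
    apply: (@odd_count1 _ _ _ (u, 0)); rewrite ?box_uniq //.
      by apply: (@rep_pred_box d) => //=; lia.
    move=> [x y]; rewrite /rep_pred !xpair_eqE /= eqxx /=.
    apply/idP/idP => [|/andP[/eqP -> /eqP ->]]; last by lia.
    case/andP => /andP[/eqP e c] /eqP y0; have {}y0 : y = 0 by lia.
    subst y; suff : x = u \/ x = - u by lia.
    have : (x - u) * (x + u) = 0 by nia.
    by move/eqP; rewrite mulf_eq0; lia.
  rewrite (eq_count (a2 := pred0)) ?count_pred0 // => -[u v] /=.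
  apply/negP => /andP[/andP[/= /eqP e c] /eqP[v0]].
  have {}v0 : v = 0 by lia.
  case/negP: nsq; apply/is_sqmulP => //; exists `|u|%N; nia.
- have -> : is_sqmul 1 M = false.
    by apply/negP => /(is_sqmulP _ (ltn0Sn 0))[k /eqP/sq1_mod]; lia.
  rewrite /= /rep_count (@odd_count_invol _ (fun p => (- p.1, p.2))) ?box_uniq //; last first.
    move=> [u v] _ /andP[/eqP /= e c]; have m := rep_form_mod3 d3 e.
    split; [|apply/andP; split => /=|by rewrite /= opprK].
    + by apply: (@rep_pred_box d) => //=; rewrite sqrrN.
    + by rewrite sqrrN e.
    + lia.
  case: (boolP (is_sqmul d M)) => [/(is_sqmulP _ d0)[k ek] | nsq].
    have := @rep_form_mod3 d M 0 k%:Z d3 => /(_ ltac:(lia)) m.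
    have [v [ev v3]] : exists v : int, v ^+ 2 = k%:Z ^+ 2 /\ (v %% 3)%Z = 2.
      have [k1|k2] : (k %% 3 = 1)%N \/ (k %% 3 = 2)%N by lia.
        by exists (- k%:Z); rewrite sqrrN; lia.
      by exists k%:Z; lia.
    apply: (@odd_count1 _ _ _ (0, v)); rewrite ?box_uniq //.
      by apply: (@rep_pred_box d) => //=; rewrite ev; lia.
    move=> [x y]; rewrite /rep_pred !xpair_eqE /= eqxx /=.
    apply/idP/idP => [|/andP[/eqP -> /eqP ->]]; last by rewrite ev; lia.
    case/andP => /andP[/eqP e c] /andP[/eqP x0 _]; have {}x0 : x = 0 by lia.
    subst x; suff : y = v \/ y = - v by lia.
    have : d%:Z * ((y - v) * (y + v)) = 0.
      by rewrite -subr_sqr ev mulrBr; lia.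
    by move/eqP; rewrite !mulf_eq0; lia.
  rewrite (eq_count (a2 := pred0)) ?count_pred0 // => -[u v] /=.
  apply/negP => /andP[/andP[/= /eqP e c] /eqP[u0]].
  have {}u0 : u = 0 by lia.
  case/negP: nsq; apply/is_sqmulP => //; exists `|v|%N.
  have : `|v|%N%:Z ^+ 2 = v ^+ 2 by lia.
  rewrite u0 in e; lia.
Qed.

(* Division by 1 + sqrt(-2), an element of norm 3. *)
Lemma rep_count2_dvd3 M : (3 %| M)%N -> rep_count 2 M = rep_count 2 (M %/ 3).
Proof.
move=> M3.
apply: (@count_bij _ _ _ _ _ _
  (fun p => (- ((p.1 + 2 * p.2) %/ 3)%Z, ((p.1 - p.2) %/ 3)%Z))
  (fun q => (- q.1 + 2 * q.2, - q.1 - q.2))); rewrite ?box_uniq //.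
- move=> [u v] _ /andP[/eqP /= e c]; have m := @rep_form_mod3 2 M u v erefl e.
  (* As 3 divides M and u + v is 2 modulo 3, both [u] and [v] are 1 modulo 3. *)
  have [b eu] : exists b, u = v + 3 * b by exists ((u - v) %/ 3)%Z; lia.
  subst u.
  have -> : ((v + 3 * b + 2 * v) %/ 3)%Z = v + b by lia.
  have -> : ((v + 3 * b - v) %/ 3)%Z = b by lia.
  have e' : (- (v + b)) ^+ 2 + 2 * b ^+ 2 = (M %/ 3)%N%:Z by nia.
  split; [exact: (@rep_pred_box 2) | apply/andP; split => /=; lia | congr pair; ring].
- move=> [a b] _ /andP[/eqP /= e c].
  have e' : (- a + 2 * b) ^+ 2 + 2 * (- a - b) ^+ 2 = M%:Z by nia.
  split; [exact: (@rep_pred_box 2) | apply/andP; split => /=; lia | congr pair; lia].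
Qed.

(* Division by 2 - sqrt(-5), an element of norm 9. *)
Lemma rep_count5_dvd9 M : (9 %| M)%N -> rep_count 5 M = rep_count 5 (M %/ 9).
Proof.
move=> M9.
apply: (@count_bij _ _ _ _ _ _
  (fun p => (((2 * p.1 - 5 * p.2) %/ 9)%Z, ((p.1 + 2 * p.2) %/ 9)%Z))
  (fun q => (2 * q.1 + 5 * q.2, - q.1 + 2 * q.2))); rewrite ?box_uniq //.
- move=> [u v] _ /andP[/eqP /= e c]; have m := @rep_form_mod3 5 M u v erefl e.
  have [b ev] : exists b, v = 1 + 3 * b by exists (v %/ 3)%Z; lia.
  have [a eu] : exists a, u = 1 + 3 * a by exists (u %/ 3)%Z; lia.
  (* Modulo 9 the form equals 6 + 6a + 30b, so 9 dividing M forces a = b + 2 modulo 3; this makes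
     both quotients by 9 exact. *)
  have [w ea] : exists w, a = 3 * w + b + 2.
    exists ((a - b - 2) %/ 3)%Z; subst u v.
    have : 6 + 6 * a + 30 * b + 9 * (a ^+ 2 + 5 * b ^+ 2) = M%:Z by rewrite -e; ring.
    lia.
  subst a u v.
  have -> : ((2 * (1 + 3 * (3 * w + b + 2)) - 5 * (1 + 3 * b)) %/ 9)%Z = 2 * w - b + 1 by lia.
  have -> : ((1 + 3 * (3 * w + b + 2) + 2 * (1 + 3 * b)) %/ 9)%Z = w + b + 1 by lia.
  have e' : (2 * w - b + 1) ^+ 2 + 5 * (w + b + 1) ^+ 2 = (M %/ 9)%N%:Z by nia.
  split; [exact: (@rep_pred_box 5) | apply/andP; split => /=; lia | congr pair; ring].
- move=> [a b] _ /andP[/eqP /= e c].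
  have e' : (2 * a + 5 * b) ^+ 2 + 5 * (- a + 2 * b) ^+ 2 = M%:Z by nia.
  split; [exact: (@rep_pred_box 5) | apply/andP; split => /=; lia | congr pair; lia].
Qed.

(* Up to sign, conjugation in Z[sqrt(-5)] followed by multiplication by
   (2 - sqrt(-5)) / 3, which has norm 1; the sign keeps u = v = 1 mod 3. *)
Definition refl3 (p : int * int) : int * int :=
  let w := ((p.1 - p.2) %/ 3)%Z in
  if (w %% 3)%Z == 0 then (p.2 - 2 * w, p.2 + w) else (- p.2 + 2 * w, - p.2 - w).

(** The involution [refl3] has no fixed point: one would have u = v or u = -5v, making M equal to 6
    v^2 or 30 v^2, which is even. *)
Lemma odd_rep_count5_dvd3 M : odd M -> (3 %| M)%N -> ~~ (9 %| M)%N ->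
  odd (rep_count 5 M) = false.
Proof.
move=> oM M3 M9.
have red u v : rep_pred 5 M (u, v) ->
    exists w, [/\ u = v + 3 * w, (v %% 3)%Z = 1 & (w %% 3)%Z != 2].
  case/andP => /eqP /= e c; have m := @rep_form_mod3 5 M u v erefl e.
  (* The class w = 2 modulo 3 is excluded because it would make M divisible by 9. *)
  exists ((u - v) %/ 3)%Z; split; [lia | lia | apply/negP => /eqP w3].
  have [b ev] : exists b, v = 1 + 3 * b by exists (v %/ 3)%Z; lia.
  have [a ew] : exists a, u = v + 3 * (3 * a + 2) by exists (((u - v) %/ 3)%Z %/ 3)%Z; lia.
  subst u v.
  have : 9 * (9 * a ^+ 2 + 14 * a + 6 * a * b + 6 + 8 * b + 6 * b ^+ 2) = M%:Z.
    by rewrite -e; ring.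
  lia.
rewrite /rep_count (@odd_count_invol _ refl3) ?box_uniq //; last first.
  move=> [u v] _ h; have [w [eu v3 w3]] := red u v h.
  case/andP: h => /= /eqP e c; subst u; rewrite /refl3 /=.
  have -> : ((v + 3 * w - v) %/ 3)%Z = w by lia.
  case: ifP => w0 /=.
    have -> : ((v - 2 * w - (v + w)) %/ 3)%Z = - w by lia.
    have -> : ((- w) %% 3)%Z = 0 by lia.
    have e' : (v - 2 * w) ^+ 2 + 5 * (v + w) ^+ 2 = M%:Z by rewrite -e; ring.
    split; [exact: (@rep_pred_box 5) | apply/andP; split => /=; lia | congr pair; ring].
  have -> : ((- v + 2 * w - (- v - w)) %/ 3)%Z = w by lia.
  rewrite w0.
  have e' : (- v + 2 * w) ^+ 2 + 5 * (- v - w) ^+ 2 = M%:Z by rewrite -e; ring.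
  split; [exact: (@rep_pred_box 5) | apply/andP; split => /=; lia | congr pair; ring].
rewrite (eq_count (a2 := pred0)) ?count_pred0 // => -[u v].
apply/negP => /andP[h]; have [w [eu v3 w3]] := red u v h.
case/andP: h => /= /eqP e c; subst u; rewrite /refl3 /=.
have -> : ((v + 3 * w - v) %/ 3)%Z = w by lia.
case: ifP => w0; rewrite xpair_eqE => /andP[/eqP e1 /eqP e2].
  have w00 : w = 0 by lia.
  subst w; have : 2 * (3 * v ^+ 2) = M%:Z by rewrite -e; ring.
  lia.
have w00 : w = - 2 * v by lia.
subst w; have : 2 * (15 * v ^+ 2) = M%:Z by rewrite -e; ring.
lia.
Qed.

(** Descent on M: dividing by 3 exchanges squares with triples of squares. Once 3 no longer divides
    M, neither 2 k^2 nor 3 k^2 can equal the odd number M. *)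
Lemma odd_rep_count2 M : odd M -> odd (rep_count 2 M) = is_sqmul 1 M (+) is_sqmul 3 M.
Proof.
have [n] := ubnP M; elim: n M => // n IH M ltM oM.
have [M3 | M3] := boolP (3 %| M)%N; last first.
  rewrite odd_rep_count_ndvd3 //; congr addb; apply/is_sqmulP/is_sqmulP => // -[k ek]; lia.
have [m em] : exists m, M = (3 * m)%N by exists (M %/ 3)%N; lia.
rewrite rep_count2_dvd3 // IH; [|lia|lia].
have -> : (M %/ 3)%N = m by lia.
rewrite addbC; congr addb; apply/is_sqmulP/is_sqmulP => // -[k ek].
- by exists (3 * k)%N; nia.
- have : (3 %| k ^ 2)%N by lia.
  by rewrite Euclid_dvdX // => /andP[/dvdnP[j ej] _]; exists j; subst k; nia.
- by exists k; lia.
- by exists k; lia.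
Qed.

(** Descent on M by factors of 9, which preserve both conditions on the right. If 3 divides M
    exactly once, both sides vanish. *)
Lemma odd_rep_count5 M : odd M -> odd (rep_count 5 M) = is_sqmul 1 M (+) is_sqmul 5 M.
Proof.
have [n] := ubnP M; elim: n M => // n IH M ltM oM.
have [M3 | M3] := boolP (3 %| M)%N; last by rewrite odd_rep_count_ndvd3.
have sq3 k : (3 %| k ^ 2 -> exists j, k = 3 * j)%N.
  by rewrite Euclid_dvdX // => /andP[/dvdnP[j ej] _]; exists j; lia.
have [M9 | M9] := boolP (9 %| M)%N; last first.
  have sqN d : (0 < d)%N -> ~~ (3 %| d)%N -> is_sqmul d M = false.
    move=> d0 d3; apply/negP => /(is_sqmulP _ d0) [k ek].
    have [|j ej] := sq3 k; last by subst k; nia.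
    by move: M3; rewrite -ek Euclid_dvdM // (negPf d3).
  by rewrite odd_rep_count5_dvd3 // !sqN.
have [m em] : exists m, M = (9 * m)%N by exists (M %/ 9)%N; lia.
rewrite rep_count5_dvd9 // IH; [|lia|lia].
have -> : (M %/ 9)%N = m by lia.
congr addb; apply/is_sqmulP/is_sqmulP => // -[k ek].
- by exists (3 * k)%N; nia.
- by have [|j ej] := sq3 k; [lia | exists j; subst k; nia].
- by exists (3 * k)%N; nia.
- by have [|j ej] := sq3 k; [lia | exists j; subst k; nia].
Qed.

(** * Pentagonal and triangular numbers, counted modulo 2 *)

(** Generalized pentagonal numbers; the product is never negative and always even, so [absz] and the
    division lose nothing. *)
Definition pent (k : int) : nat := (absz (k * (3 * k - 1))%R %/ 2)%N.

Lemma pentE k : (2 * pent k)%N%:Z = k * (3 * k - 1).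
Proof.
suff : (2 %| absz (k * (3 * k - 1))%R)%N by rewrite /pent; nia.
have [a [] e] : exists a, k = 2 * a \/ k = 2 * a + 1 by exists (k %/ 2)%Z; lia.
  have -> : k * (3 * k - 1) = 2 * (a * (6 * a - 1)) by rewrite e; ring.
  lia.
have -> : k * (3 * k - 1) = 2 * ((2 * a + 1) * (3 * a + 1)) by rewrite e; ring.
lia.
Qed.

Lemma pent_sqr k : 24 * (pent k)%:Z + 1 = (6 * k - 1) ^+ 2.
Proof. by have := pentE k; nia. Qed.

Lemma abs_le_pent k : (absz k <= pent k)%N.
Proof. by have := pentE k; nia. Qed.

Lemma sqr_mod2 (u : int) : (u ^+ 2 %% 2)%Z = (u %% 2)%Z.
Proof.
have [a [] e] : exists a, u = 2 * a \/ u = 2 * a + 1 by exists (u %/ 2)%Z; lia.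
  have -> : u ^+ 2 = 2 * (2 * a ^+ 2) by rewrite e; ring.
  lia.
have -> : u ^+ 2 = 2 * (2 * a ^+ 2 + 2 * a) + 1 by rewrite e; ring.
lia.
Qed.

(** With x = 6k - 1 and y = 6l - 1 the equation reads x^2 + 2 y^2 = 3 (8i + 1); then u = (x + 2y) /
    3 and v = (y - x) / 3 represent 8i + 1. *)
Lemma odd_count_pent2 i N : (i < N)%N ->
  odd (count (fun p => pent p.1 + 2 * pent p.2 == i)%N (box N))
  = is_sqmul 1 (8 * i + 1).
Proof.
move=> ltiN.
have -> : is_sqmul 1 (8 * i + 1) = odd (rep_count 2 (8 * i + 1)).
  rewrite odd_rep_count2; last by lia.
  suff -> : is_sqmul 3 (8 * i + 1) = false by rewrite addbF.
  (* 3 k^2 is 0 modulo 4 or 3 modulo 8, never 1 modulo 8. *)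
  apply/negP => /(is_sqmulP _ (ltn0Sn 2))[k ek].
  have [a [] e] : exists a, (k = 2 * a \/ k = 2 * a + 1)%N by exists (k %/ 2)%N; lia.
    by subst k; lia.
  have : (2 %| a * (a + 1))%N by lia.
  by subst k; lia.
congr odd; apply: (@count_bij _ _ _ _ _ _
  (fun p => (2 * (p.1 + 2 * p.2) - 1, 2 * (p.2 - p.1)))
  (fun q => (((q.1 - 2 * q.2 + 1) %/ 6)%Z, ((q.1 + q.2 + 1) %/ 6)%Z)));
  rewrite ?box_uniq //.
- move=> [k l] _ /= /eqP e; have := pent_sqr k; have := pent_sqr l => sl sk.
  have e' : (2 * (k + 2 * l) - 1) ^+ 2 + 2 * (2 * (l - k)) ^+ 2 = (8 * i + 1)%N%:Z by nia.
  split; [exact: (@rep_pred_box 2) | apply/andP; split => /=; lia | congr pair; lia].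
- move=> [u v] _ /andP[/= /eqP e c].
  have := sqr_mod2 u; have := sqr_mod2 v => v2 u2.
  have [w eu] : exists w, u = 2 * w + 1 by exists (u %/ 2)%Z; lia.
  (* An odd square is 1 modulo 8, so 2 v^2 is divisible by 8. *)
  have [z ev] : exists z, v = 2 * z.
    exists (v %/ 2)%Z; subst u.
    have : 4 * (w * (w + 1)) + 2 * v ^+ 2 = 8 * i%:Z by nia.
    move: (w * _) => y; clear -v2; move: (v ^+ 2) v2 => x v2.
    lia.
  (* u + v is odd and 2 modulo 3, hence -1 modulo 6. *)
  have {w eu} [l el] : exists l, u = 6 * l - 1 - v by exists ((u + v + 1) %/ 6)%Z; lia.
  have [k ek] : exists k, z = l - k by exists (l - z); lia.
  subst u v z.
  have -> : ((6 * l - 1 - 2 * (l - k) - 2 * (2 * (l - k)) + 1) %/ 6)%Z = k by lia.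
  have -> : ((6 * l - 1 - 2 * (l - k) + 2 * (l - k) + 1) %/ 6)%Z = l by lia.
  have := pent_sqr k; have := pent_sqr l => sl sk.
  have e' : (pent k + 2 * pent l = i)%N.
    have : (6 * k - 1) ^+ 2 + 2 * (6 * l - 1) ^+ 2
         = 3 * ((6 * l - 1 - 2 * (l - k)) ^+ 2 + 2 * (2 * (l - k)) ^+ 2) by ring.
    by rewrite e -sk -sl; clear; lia.
  have bk := abs_le_pent k; have bl := abs_le_pent l.
  by split; [rewrite mem_box /=; clear -bk bl e' ltiN; lia | rewrite /= e' | congr pair; ring].
Qed.

(** Here x^2 + 5 y^2 = 6 (4i + 1) with x = 6k - 1 and y = 6l - 1, and u = (x + 5y) / 6, v = (y - x)
    / 6. *)
Lemma odd_count_pent5 i N : (i < N)%N ->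
  odd (count (fun p => pent p.1 + 5 * pent p.2 == i)%N (box N))
  = is_sqmul 1 (4 * i + 1) (+) is_sqmul 5 (4 * i + 1).
Proof.
move=> ltiN; rewrite -odd_rep_count5; last by lia.
congr odd; apply: (@count_bij _ _ _ _ _ _
  (fun p => (p.1 + 5 * p.2 - 1, p.2 - p.1))
  (fun q => (((q.1 - 5 * q.2 + 1) %/ 6)%Z, ((q.1 + q.2 + 1) %/ 6)%Z)));
  rewrite ?box_uniq //.
- move=> [k l] _ /= /eqP e; have := pent_sqr k; have := pent_sqr l => sl sk.
  have e' : (k + 5 * l - 1) ^+ 2 + 5 * (l - k) ^+ 2 = (4 * i + 1)%N%:Z by nia.
  split; [exact: (@rep_pred_box 5) | apply/andP; split => /=; lia | congr pair; lia].
- move=> [u v] _ /andP[/= /eqP e c].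
  have := sqr_mod2 u; have := sqr_mod2 v => v2 u2.
  have [w ew] : exists w, u = 2 * w + 1 - v by exists ((u + v) %/ 2)%Z; lia.
  have {w ew} [l el] : exists l, u = 6 * l - 1 - v by exists ((u + v + 1) %/ 6)%Z; lia.
  have [k ek] : exists k, v = l - k by exists (l - v); lia.
  subst u v.
  have -> : ((6 * l - 1 - (l - k) - 5 * (l - k) + 1) %/ 6)%Z = k by lia.
  have -> : ((6 * l - 1 - (l - k) + (l - k) + 1) %/ 6)%Z = l by lia.
  have := pent_sqr k; have := pent_sqr l => sl sk.
  have e' : (pent k + 5 * pent l = i)%N.
    have : (6 * k - 1) ^+ 2 + 5 * (6 * l - 1) ^+ 2
         = 6 * ((6 * l - 1 - (l - k)) ^+ 2 + 5 * (l - k) ^+ 2) by ring.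
    by rewrite e -sk -sl; clear; lia.
  have bk := abs_le_pent k; have bl := abs_le_pent l.
  by split; [rewrite mem_box /=; clear -bk bl e' ltiN; lia | rewrite /= e' | congr pair; ring].
Qed.

Lemma mul2_bin2 s : (2 * 'C(s.+1, 2) = s.+1 * s)%N.
Proof. by elim: s => // s IH; rewrite binS bin1 mulnDr IH; lia. Qed.

(** Completing the square turns the equation into (4b + 1)(2j + 1)^2 = 4i + 1, which has at most one
    solution j. The case b = 0 serves psi_2 and b = 1 serves q psi_10. *)
Lemma odd_count_tri b i N : (i < 2 * N)%N ->
  odd (count (fun j => 2 * (4 * b + 1) * 'C(j.+1, 2) + b == i)%N (iota 0 N))
  = is_sqmul (4 * b + 1) (4 * i + 1).
Proof.
move=> ltiN; set d := (4 * b + 1)%N.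
have d0 : (0 < d)%N by rewrite /d; lia.
have tri j : (4 * (2 * d * 'C(j.+1, 2) + b) + 1 = d * (2 * j + 1) ^ 2)%N.
  by have := mul2_bin2 j; rewrite /d; nia.
case: (boolP (is_sqmul _ _)) => [/(is_sqmulP _ d0)[k ek] | nsq].
  have : odd (d * k ^ 2) by rewrite ek; lia.
  rewrite oddM oddX /= => /andP[_ ok].
  have [j ej] : exists j, (k = 2 * j + 1)%N by exists (k %/ 2)%N; lia.
  subst k; move: ek; rewrite -tri => ek.
  apply: (@odd_count1 _ _ _ j); rewrite ?iota_uniq //.
    have : (j <= 'C(j.+1, 2))%N by have := mul2_bin2 j; nia.
    by rewrite mem_iota; nia.
  move=> x; apply/eqP/eqP => [ex | ->]; last by lia.
  have : (d * (2 * x + 1) ^ 2 = d * (2 * j + 1) ^ 2)%N by rewrite -!tri; lia.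
  by move/eqP; rewrite eqn_pmul2l // eqn_sqr; lia.
rewrite (eq_count (a2 := pred0)) ?count_pred0 // => j /=.
apply/negP => /eqP ej; case/negP: nsq; apply/is_sqmulP => //.
by exists (2 * j + 1)%N; rewrite -ej tri.
Qed.

(** * Truncated power series over the field with two elements *)

Lemma natF2 n : n%:R = (odd n)%:R :> 'F_2.
Proof. by apply/val_inj; rewrite /= !val_Fp_nat // !modn2 oddb. Qed.

(** Congruence modulo ['X^N], which lets polynomials stand for power series. *)
Definition eqX (N : nat) (p q : {poly 'F_2}) : Prop :=
  forall i, (i < N)%N -> p`_i = q`_i.

Lemma eqX_refl N p : eqX N p p. Proof. by []. Qed.

Lemma eqX_sym N p q : eqX N p q -> eqX N q p.
Proof. by move=> h i /h. Qed.

Lemma eqX_trans N q p r : eqX N p q -> eqX N q r -> eqX N p r.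
Proof. by move=> h1 h2 i lti; rewrite h1 // h2. Qed.

Lemma eqXD N p p' q q' : eqX N p p' -> eqX N q q' -> eqX N (p + q) (p' + q').
Proof. by move=> h1 h2 i lti; rewrite !coefD h1 // h2. Qed.

Lemma eqXM N p p' q q' : eqX N p p' -> eqX N q q' -> eqX N (p * q) (p' * q').
Proof.
move=> h1 h2 i lti; rewrite !coefM; apply: eq_bigr => j _.
by rewrite h1 ?h2 //; have := ltn_ord j; lia.
Qed.

Lemma coef_sumX (T : Type) (s : seq T) (e : T -> nat) i :
  (\sum_(x <- s) 'X^(e x) : {poly 'F_2})`_i = (count (fun x => e x == i) s)%:R.
Proof.
rewrite coef_sum; elim: s => [|x s IH]; first by rewrite big_nil.
by rewrite big_cons IH coefXn eq_sym /= natrD.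
Qed.

Lemma eqX_sumX (T U : Type) N (s : seq T) (t : seq U) (e : T -> nat) (g : U -> nat) :
  (forall i, (i < N)%N -> odd (count (fun x => e x == i) s)
                        = odd (count (fun y => g y == i) t)) ->
  eqX N (\sum_(x <- s) 'X^(e x)) (\sum_(y <- t) 'X^(g y)).
Proof. by move=> h i /h eo; rewrite !coef_sumX natF2 eo -natF2. Qed.

Lemma sqr_sumF2 (T : Type) (s : seq T) (F : T -> {poly 'F_2}) :
  (\sum_(x <- s) F x) ^+ 2 = \sum_(x <- s) F x ^+ 2.
Proof.
have ch : 2%N \in [pchar {poly 'F_2}] by rewrite pchar_poly pchar_Fp.
by rewrite -(pFrobenius_autE ch) rmorph_sum; apply: eq_bigr => x _; apply: pFrobenius_autE.
Qed.

(** Truncation of f_c; for positive [c] it is exact below degree [N], since |k| is at most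
    [pent k]. *)
Definition pentS N c : {poly 'F_2} := \sum_(k <- zseq N) 'X^(c * pent k).

Definition triS N c : {poly 'F_2} := \sum_(j <- iota 0 N) 'X^(c * 'C(j.+1, 2)).

Lemma pentS_sqr N c : pentS N c ^+ 2 = pentS N (2 * c).
Proof. by rewrite sqr_sumF2; apply: eq_bigr => k _; rewrite -exprM; congr 'X^_; lia. Qed.

Lemma triS_sqr N c : triS N c ^+ 2 = triS N (2 * c).
Proof. by rewrite sqr_sumF2; apply: eq_bigr => k _; rewrite -exprM; congr 'X^_; lia. Qed.

Lemma pentSM N a b :
  pentS N a * pentS N b = \sum_(p <- box N) 'X^(a * pent p.1 + b * pent p.2).
Proof.
rewrite big_allpairs mulr_suml; apply: eq_bigr => k _.
by rewrite mulr_sumr; apply: eq_bigr => l _; rewrite -exprD.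
Qed.

Lemma pentS_mul2 N c : (0 < c)%N -> eqX N (pentS N c * pentS N (2 * c)) (triS N c).
Proof.
move=> c0; rewrite pentSM; apply: eqX_sumX => i lti.
(* All exponents on both sides are multiples of [c], so only i = j c matters and the claim reduces
   to c = 1. *)
have [/dvdnP[j ej] | ndvd] := boolP (c %| i)%N; last first.
  have nX m : (c * m)%N == i = false.
    by apply: contraNF ndvd => /eqP <-; rewrite dvdn_mulr.
  under eq_count do rewrite -mulnA mulnCA -mulnDr nX.
  by under [in RHS]eq_count do rewrite nX; rewrite !count_pred0.
subst i; have ltj : (j < N)%N by nia.
transitivity (is_sqmul 1 (8 * j + 1)); last first.
  have -> : (8 * j + 1 = 4 * (2 * j) + 1)%N by lia.
  rewrite -(@odd_count_tri 0 _ N); last by lia.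
  by congr odd; apply: eq_count => k; nia.
by rewrite -(odd_count_pent2 ltj); congr odd; apply: eq_count => k; nia.
Qed.

Lemma pentS1_mul5 N : eqX N (pentS N 1 * pentS N 5) (triS N 2 + 'X * triS N 10).
Proof.
move=> i lti; rewrite /triS mulr_sumr; under [in X in _ + X]eq_bigr do rewrite -exprS.
rewrite pentSM coefD !coef_sumX !(natF2 (count _ _)).
under eq_count do rewrite mul1n.
have lt2 : (i < 2 * N)%N by lia.
rewrite odd_count_pent5 // -(@odd_count_tri 0 _ N) // -(@odd_count_tri 1 _ N) //.
under [in X in odd X (+) _]eq_count do rewrite addn0.
under [in X in _ (+) odd X]eq_count do rewrite addn1.
by case: (odd _); case: (odd _); apply/val_inj.
Qed.

Lemma addF2 (p : {poly 'F_2}) : p + p = 0.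
Proof. by rewrite addrr_pchar2 // pchar_poly pchar_Fp. Qed.

(** * Euler's pentagonal number theorem modulo 2 *)

Definition dprod (n s : nat) : {poly 'F_2} := \prod_(s <= i < n) (1 + 'X^(i.+1)).

(* Shanks: this sum is the truncated pentagonal series, and its s = 0 term is
   the Euler product up to n. *)
Definition shanks (n : nat) : {poly 'F_2} :=
  \sum_(0 <= s < n.+1) dprod n s * 'X^(s * n + 'C(s.+1, 2)).

(** The new top term s = n + 1 is the second pentagonal power. Each other term splits into its
    counterpart in [shanks n] and two pieces that telescope in s, leaving the first pentagonal
    power. *)
Lemma shanksS n :
  shanks n.+1 = shanks n + 'X^(pent n.+1%:Z) + 'X^(pent (- n.+1%:Z)).
Proof.
have tri s : 'C(s.+2, 2) = ('C(s.+1, 2) + s.+1)%N by rewrite binS bin1 addnC.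
have dd m : dprod m m = 1 by rewrite /dprod big_geq.
rewrite /shanks big_nat_recr //= dd mul1r.
have -> : (n.+1 * n.+1 + 'C(n.+2, 2))%N = pent (- n.+1%:Z).
  by have := pentE (- n.+1%:Z); have := mul2_bin2 n.+1; nia.
congr (_ + _).
under eq_big_nat => s /andP[_ les].
  rewrite (_ : dprod n.+1 s * _ = dprod n s * 'X^(s * n + 'C(s.+1, 2))
    + (dprod n s * (1 + 'X^s) * 'X^(s * n + 'C(s.+1, 2))
       + dprod n s * 'X^(s.+1 * n.+1 + 'C(s.+1, 2)))); last first.
    rewrite /dprod big_nat_recr //= -!mulrA -!mulrDr; congr (_ * _).
    rewrite !mulrDl !mul1r -!exprD addrA addrA addF2 add0r; congr ('X^_ + 'X^_); lia.
  over.
rewrite big_split /=; congr (_ + _); rewrite big_split /=.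
(* The first piece vanishes at s = 0, where 1 + 1 = 0; at s + 1 it cancels the second piece at s, so
   only the second piece at s = n remains. *)
rewrite big_nat_recl //= expr0 addF2 mulr0 mul0r add0r.
rewrite [X in _ + X]big_nat_recr //= dd mul1r addrA.
rewrite (eq_big_nat _ _ (F2 := fun s => dprod n s * 'X^(s.+1 * n.+1 + 'C(s.+1, 2)))).
  rewrite addF2 add0r; congr 'X^_.
  by have := pentE n.+1%:Z; have := mul2_bin2 n; nia.
move=> s /andP[_ les]; rewrite /dprod [in RHS]big_ltn // [_ * (1 + _)]mulrC.
by congr (_ * 'X^_); rewrite tri; lia.
Qed.

Lemma shanks_pentS n : shanks n = pentS n 1.
Proof.
elim: n => [|n IH].
  by rewrite /shanks /pentS big_nat1 /dprod big_geq // mul1r big_seq1.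
rewrite shanksS IH /pentS [RHS](perm_big (n.+1%:Z :: - n.+1%:Z :: zseq n)); last first.
  apply: uniq_perm; first exact: zseq_uniq.
    have := mem_zseq n; have := zseq_uniq n; move: (zseq n) => z uz mz.
    by rewrite /= uz inE !mz; lia.
  by move=> x; rewrite mem_zseq 2!in_cons mem_zseq; lia.
by move: (zseq n) => z; rewrite !big_cons !mul1n /= -addrA addrC -addrA.
Qed.

Lemma pentS_prod N : eqX N (pentS N 1) (dprod N 0).
Proof.
rewrite -shanks_pentS /shanks big_nat_recl //= mul0n expr0 mulr1 => i lti.
rewrite coefD coef_sum big1_seq ?addr0 // => s _.
(* The terms with s > 0 have no exponent below N. *)
by rewrite coefMXn ifT //; nia.
Qed.

(** * The generating function of partitions *)

Definition ptns (n : nat) : seq (seq nat) :=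
  [seq s <- [seq map val t | t : {bseq n of 'I_n.+1}] | is_partition n s].

Lemma ptns_uniq n : uniq (ptns n).
Proof.
rewrite filter_uniq // map_inj_uniq ?enum_uniq // => t u /(inj_map val_inj) h.
exact: val_inj.
Qed.

Lemma mem_ptns n s : (s \in ptns n) = is_partition n s.
Proof.
rewrite mem_filter; case: (boolP (is_partition n s)) => //= hs.
have /and3P[_ pos /eqP sn] := hs.
have lt_s : all (fun k => k < n.+1)%N s.
  by apply/allP => k /leq_sumn_mem; rewrite sn ltnS.
have es : map val (map (@inord n) s) = s.
  rewrite -map_comp -[RHS]map_id; apply/eq_in_map => k /(allP lt_s) h /=.
  by rewrite inordK.
have sz : (size (map (@inord n) s) <= n)%N.
  by rewrite size_map -[X in (_ <= X)%N]sn size_leq_sumn.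
by apply/mapP; exists (Bseq sz); rewrite ?mem_enum //= es.
Qed.

Lemma geq_sorted_eq s t : sorted geq s -> sorted geq t -> perm_eq s t -> s = t.
Proof. by apply: sorted_eq => [x y z|x y]; rewrite /geq /=; lia. Qed.

(** Removing one copy of [a] is a bijection onto the partitions of n - a, inverted by inserting [a]
    and sorting. *)
Lemma count_ptns_mem (a n : nat) (Q : pred (seq nat)) : (0 < a)%N ->
  (forall s t, perm_eq s (a :: t) -> Q s = Q t) ->
  count (fun s => (a \in s) && Q s) (ptns n)
  = if (a <= n)%N then count Q (ptns (n - a)) else 0%N.
Proof.
move=> a0 hQ; have [le_an | lt_na] := leqP a n; last first.
  rewrite (eq_in_count (a2 := pred0)) ?count_pred0 // => s; rewrite mem_ptns /=.
  move=> /and3P[_ _ /eqP sn]; apply/negP => /andP[/leq_sumn_mem]; lia.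
have totg : total geq by move=> x y; rewrite /geq /=; lia.
have trg : transitive geq by move=> x y z; rewrite /geq /=; lia.
apply: (@count_bij _ _ _ _ _ _ (rem a) (fun t => sort geq (a :: t)));
  rewrite ?ptns_uniq // => s; rewrite mem_ptns => /and3P[so po /eqP sn].
- move=> /andP[sa Qs]; have pr := perm_to_rem sa.
  have sr : sorted geq (rem a s) by apply: subseq_sorted so => //; apply: rem_subseq.
  split; rewrite ?mem_ptns.
  + apply/and3P; split=> //.
      by apply/allP => x /mem_rem; apply: (allP po).
    by have := perm_sumn pr; rewrite /= sn; lia.
  + by rewrite -(hQ s).
  + by apply: geq_sorted_eq; rewrite ?sort_sorted // perm_sort perm_sym.
- move=> Qs; have ps : perm_eq (sort geq (a :: s)) (a :: s) by rewrite perm_sort.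
  have sa : a \in sort geq (a :: s) by rewrite mem_sort mem_head.
  split; rewrite ?mem_ptns.
  + apply/and3P; split; first exact: sort_sorted.
      by rewrite (perm_all _ ps) /= po a0.
    by rewrite (perm_sumn ps) /= sn; lia.
  + by rewrite sa (hQ _ _ ps).
  + apply: geq_sorted_eq => //.
      by apply: subseq_sorted (sort_sorted totg _) => //; apply: rem_subseq.
    by rewrite -(perm_cons a) -(permPl (perm_to_rem sa)).
Qed.

Definition npart (m n : nat) : nat := count (all (fun x => x <= m)%N) (ptns n).

Lemma npartS m n :
  npart m.+1 n = (npart m n + if (m.+1 <= n)%N then npart m.+1 (n - m.+1) else 0)%N.
Proof.
rewrite -count_ptns_mem // => [|s t ps]; last by rewrite (perm_all _ ps) /= leqnn.
rewrite /npart -[RHS]count_predUI [X in (_ + X)%N](eq_count (a2 := pred0)); last first.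
  move=> s /=; apply/negP => /and3P[sm ms _].
  by have := allP sm _ ms; rewrite ltnn.
rewrite count_pred0 addn0; apply: eq_count => s /=.
apply/idP/idP => [sm | /orP[sm | /andP[]//]].
  have [ms | nms] := boolP (m.+1 \in s); first by rewrite sm orbT.
  rewrite orbF; apply/allP => x sx; have := allP sm _ sx.
  by rewrite leq_eqVlt ltnS => /predU1P[ex | //]; rewrite -ex sx in nms.
by apply: sub_all sm => x /leqW.
Qed.

Definition partS N m : {poly 'F_2} := \poly_(n < N) (npart m n)%:R.

(** By [npartS], the partitions containing the part m + 1 are counted twice and cancel modulo 2. *)
Lemma partS_step N m : eqX N ((1 + 'X^(m.+1)) * partS N m.+1) (partS N m).
Proof.
move=> n ltn; rewrite mulrDl mul1r coefD coefXnM !coef_poly ltn npartS.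
have -> : (n - m.+1 < N)%N by lia.
case: (leqP m.+1 n) => _ /=; last by rewrite addn0 addr0.
by rewrite natrD -addrA addrr_pchar2 ?addr0 // pchar_Fp.
Qed.

Lemma partS_0 N : eqX N (partS N 0) 1.
Proof.
move=> n ltn; rewrite coef_poly ltn coef1 /npart.
case: n ltn => [|n] ltn /=.
  have -> : ptns 0 = [:: [::]].
    apply/perm_small_eq => //; apply: uniq_perm; rewrite ?ptns_uniq // => s.
    rewrite mem_ptns inE; apply/idP/eqP => [/and3P[_ po /eqP s0] | -> //].
    by have := size_leq_sumn po; rewrite s0; case: s {po s0}.
  by [].
rewrite (eq_in_count (a2 := pred0)) ?count_pred0 // => s.
rewrite mem_ptns /= => /and3P[_ po /eqP sn]; apply/negP => h.
case: s po sn h => //= x s /andP[x0 _] _ /andP[]; lia.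
Qed.

Lemma partS_prod N m : eqX N (dprod m 0 * partS N m) 1.
Proof.
elim: m => [|m IH]; first by rewrite /dprod big_geq // mul1r; apply: partS_0.
rewrite /dprod big_nat_recr //= -mulrA; apply: eqX_trans IH.
by apply: eqXM; [apply: eqX_refl | apply: partS_step].
Qed.

Lemma partS_pentS N : eqX N (partS N N * pentS N 1) 1.
Proof.
rewrite mulrC; apply: eqX_trans (@partS_prod N N).
by apply: eqXM; [apply: pentS_prod | apply: eqX_refl].
Qed.

Lemma npart_size N n : (n <= N)%N -> npart N n = size (ptns n).
Proof.
move=> leN; apply/eqP; rewrite -all_count; apply/allP => s.
rewrite mem_ptns => /and3P[_ _ /eqP sn]; apply/allP => x /leq_sumn_mem.
by rewrite sn => h; apply: leq_trans leN.
Qed.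

(** Remove one copy of each element of [L] in turn; distinctness ensures that the later ones are
    still present. *)
Lemma count_ptns_all (L : seq nat) n : uniq L -> all (leq 1) L ->
  count (fun s => all (mem s) L) (ptns n)
  = if (sumn L <= n)%N then size (ptns (n - sumn L)) else 0%N.
Proof.
elim: L n => [|a L IH] n /=; first by rewrite subn0 count_predT.
move=> /andP[aL uL] /andP[a0 pL].
rewrite (@count_ptns_mem a n (fun s => all (mem s) L)) //.
  case: leqP => [le_an | lt_na]; last by case: leqP => //; lia.
  by rewrite IH // leq_subRL // subnDA.
move=> s t ps; apply: eq_in_all => x Lx /=.
rewrite (perm_mem ps) inE; case: eqP => // ex.
by rewrite -ex Lx in aL.
Qed.

(** * The generating function of [p55] modulo 2 *)

Definition multiples5 (j : nat) : seq nat := [seq (5 * i)%N | i <- iota 1 j].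

Lemma sumn_multiples5 j : sumn (multiples5 j) = (5 * 'C(j.+1, 2))%N.
Proof.
elim: j => // j IH; rewrite /multiples5 -(addn1 j) iotaD map_cat sumn_cat.
rewrite -/(multiples5 j) IH /= addn1.
by have := mul2_bin2 j; have := mul2_bin2 j.+1; nia.
Qed.

(** If the mex is 5m, the valid j are 0, ..., m - 1, so the count is m, and 5m is 5 modulo 10
    exactly when m is odd. *)
Lemma mex55_parity (s : seq nat) N : (sumn s < N)%N ->
  (mex55 s == 5 %[mod 10])
  = odd (count (fun j => all (mem s) (multiples5 j)) (iota 0 N)).
Proof.
move=> ltN; rewrite /mex55; case: ex_minnP => k /and3P[k0 /dvdnP[m ek] ns] mink.
subst k.
have -> : count (fun j => all (mem s) (multiples5 j)) (iota 0 N)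
        = count (fun j => j < m)%N (iota 0 N).
  apply: eq_count => j; rewrite all_map; apply/allP/idP => [h | ltj i] /=.
    rewrite ltnNge; apply/negP => lemj; case/negP: ns.
    by rewrite mulnC; apply: (h m); rewrite mem_iota; lia.
  rewrite mem_iota => hi; apply/negPn/negP => nsi.
  have := mink (5 * i)%N; rewrite nsi dvdn_mulr // andbT => /(_ ltac:(lia)); lia.
(* 5N exceeds the sum of the parts, so it is not a part and bounds the mex. *)
have lemN : (m <= N)%N.
  case: m ns mink k0 => // m ns mink _; rewrite ltnNge; apply/negP => leNm.
  have nsm : (5 * N)%N \notin s by apply/negP => /leq_sumn_mem; lia.
  have := mink (5 * N)%N; rewrite nsm dvdn_mulr // andbT => /(_ ltac:(lia)); lia.
have -> : count (fun j => j < m)%N (iota 0 N) = m.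
  rewrite -(subnKC lemN) iotaD count_cat (eq_in_count (a2 := predT)).
    rewrite count_predT size_iota (eq_in_count (a2 := pred0)) ?count_pred0 ?addn0 //.
    by move=> j; rewrite mem_iota /=; lia.
  by move=> j; rewrite mem_iota /=; lia.
lia.
Qed.

Lemma count_natr (T : Type) (R : nzSemiRingType) (P : pred T) (s : seq T) :
  (count P s)%:R = \sum_(x <- s) (P x)%:R :> R.
Proof. by elim: s => [|x s IH]; rewrite ?big_nil // big_cons /= natrD IH. Qed.

Definition p55S N : {poly 'F_2} := \poly_(n < N) (p55 n)%:R.

(** Exchange the sums over partitions and over j: for fixed j, removing 5, 10, ..., 5j leaves an
    arbitrary partition of n - 5 j(j+1)/2. *)
Lemma p55S_eq N : eqX N (p55S N) (partS N N * triS N 5).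
Proof.
move=> n ltn; rewrite coef_poly ltn (p55E (ptns_uniq n) (mem_ptns n)) count_natr.
rewrite (eq_big_seq (fun s : seq nat => \sum_(j <- iota 0 N) (all (mem s) (multiples5 j))%:R)).
  rewrite exchange_big /= /triS mulr_sumr coef_sum; apply: eq_bigr => j _.
  rewrite -count_natr count_ptns_all.
  - rewrite sumn_multiples5 coefMXn; case: (leqP (5 * 'C(j.+1, 2))%N n) => //= le_j.
    have lt_nj := leq_ltn_trans (leq_subr (5 * 'C(j.+1, 2)) n) ltn.
    by rewrite coef_poly lt_nj npart_size // ltnW.
  - by rewrite map_inj_uniq ?iota_uniq // => x y; lia.
  - by rewrite all_map; apply/allP => x; rewrite mem_iota /=; lia.
move=> s; rewrite mem_ptns => /and3P[_ _ /eqP sn].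
by rewrite -count_natr [RHS]natF2 -mex55_parity ?sn.
Qed.

(** * Dissection by the parity of the exponent *)

Lemma p55S_dissection N :
  eqX N (p55S N) ((pentS N 5 * pentS N 2) ^+ 2
                  + 'X * (partS N N * pentS N 5 * triS N 5) ^+ 2).
Proof.
set P := partS N N; have Pf : eqX N (P * pentS N 1) 1 := @partS_pentS N.
have r q := @eqX_refl N q.
apply: (eqX_trans (@p55S_eq N)); rewrite -/P.
(* Insert the factor P f_1 = 1 and write psi_5 = f_5 f_10 = f_5^3, so that f_1 f_5 appears beside a
   square. *)
apply: (@eqX_trans _ (P ^+ 2 * pentS N 5 ^+ 2 * (pentS N 1 * pentS N 5))).
  apply: (@eqX_trans _ (P * (P * pentS N 1) * (pentS N 5 * pentS N (2 * 5)))).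
    rewrite -[X in eqX _ (X * _)]mulr1.
    apply: eqXM; first by apply: eqXM => //; apply: eqX_sym.
    by apply: eqX_sym; apply: pentS_mul2.
  rewrite -pentS_sqr (_ : P * _ * _ = P ^+ 2 * pentS N 5 ^+ 2 * (pentS N 1 * pentS N 5)) //.
  ring.
apply: (eqX_trans (eqXM (r _) (@pentS1_mul5 N))).
rewrite mulrDr; apply: eqXD; last first.
  have -> : triS N 10 = triS N 5 ^+ 2 by rewrite triS_sqr.
  by rewrite (_ : _ * _ = 'X * (P * pentS N 5 * triS N 5) ^+ 2) //; ring.
(* psi_2 = psi_1^2 = (f_1 f_2)^2, and f_1^2 cancels against P^2. *)
apply: (@eqX_trans _ (pentS N 5 ^+ 2 * ((P * pentS N 1) ^+ 2 * pentS N 2 ^+ 2))).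
  have t1 : eqX N (triS N 1) (pentS N 1 * pentS N 2) by apply/eqX_sym/pentS_mul2.
  have -> : triS N 2 = triS N 1 ^+ 2 by rewrite triS_sqr.
  apply: (eqX_trans (eqXM (r _) (eqXM t1 t1))).
  rewrite (_ : _ * _ = pentS N 5 ^+ 2 * ((P * pentS N 1) ^+ 2 * pentS N 2 ^+ 2)) //.
  ring.
rewrite [X in eqX _ _ X]exprMn; apply: eqXM => //; rewrite -[X in eqX _ _ X]mul1r; apply: eqXM => //.
by have := eqXM Pf Pf; rewrite mulr1.
Qed.

(** Frobenius: p(X)^2 = p(X^2) over the field with two elements. *)
Lemma sqrF2_coef (p : {poly 'F_2}) i : (p ^+ 2)`_i = if odd i then 0 else p`_(i %/ 2).
Proof.
have sq (c : 'F_2) : c ^+ 2 = c by case: c => [[|[]]] // h; apply/val_inj.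
rewrite -[p in p ^+ 2]coefK poly_def sqr_sumF2 coef_sum.
under eq_bigr do rewrite exprZn sq -exprM coefZ coefXn.
case: ifP => oi.
  by rewrite big1 // => j _; case: eqP => [e|]; rewrite ?mulr0 //; lia.
have [lt | ge] := ltnP (i %/ 2) (size p); last first.
  rewrite nth_default // big1 // => j _; have := ltn_ord j.
  by case: eqP => [e|]; rewrite ?mulr0 //; lia.
rewrite (bigD1 (Ordinal lt)) //= big1 ?addr0; last first.
  by move=> j /eqP/val_eqP /= ne; case: eqP => [e|]; rewrite ?mulr0 //; lia.
by have -> : i == (i %/ 2 * 2)%N; [lia | rewrite mulr1].
Qed.

Lemma odd_p55_even (n : nat) : odd (p55 (2 * n)) ->
  exists x y : int, 2 * x ^+ 2 + 5 * y ^+ 2 = (24 * n + 7)%N%:Z.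
Proof.
move=> op; set N := (2 * n).+1.
have := @p55S_dissection N (2 * n) (ltnSn _).
rewrite coef_poly ltnSn natF2 op coefD coefXM !sqrF2_coef.
have -> : odd (2 * n) = false by lia.
have -> : (2 * n %/ 2 = n)%N by lia.
(* The summand with the factor ['X] has only odd exponents. *)
have -> : (if (2 * n == 0)%N then 0 else if odd (2 * n).-1 then 0 else
   (partS N N * pentS N 5 * triS N 5)`_((2 * n).-1 %/ 2)) = 0 :> 'F_2.
  by case: eqP => // n0; case: ifP => //; lia.
rewrite addr0 pentSM coef_sumX => e.
have : has (fun p => 5 * pent p.1 + 2 * pent p.2 == n)%N (box N).
  by rewrite has_count lt0n; apply/eqP => c0; move: e; rewrite c0 => /eqP.
case/hasP => -[k l] _ /= /eqP en; exists (6 * l - 1), (6 * k - 1).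
by rewrite -!pent_sqr; lia.
Qed.

(** * The form 2 x^2 + 5 y^2 modulo 5 and 25 *)

Lemma sqr_mod5 (x : int) :
  (exists y, x = 5 * y) \/ (x ^+ 2 %% 5)%Z = 1 \/ (x ^+ 2 %% 5)%Z = 4.
Proof.
have [a [r [e lt]]] : exists a, exists r : nat, x = 5 * a + r%:Z /\ (r < 5)%N.
  by exists (x %/ 5)%Z, (absz (x %% 5)%Z); lia.
have -> : x ^+ 2 = 5 * (5 * a ^+ 2 + 2 * a * r%:Z) + r%:Z ^+ 2 by rewrite e; ring.
case: r lt e => [|[|[|[|[|]]]]] // _ e; rewrite mulrC modzMDl; try by right; auto.
by left; exists a; lia.
Qed.

Lemma form_mod5 (x y : int) M : 2 * x ^+ 2 + 5 * y ^+ 2 = M%:Z ->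
  [/\ (M %% 5 != 1)%N, (M %% 5 != 4)%N
    & (5 %| M)%N -> exists2 z, x = 5 * z & y ^+ 2 + 10 * z ^+ 2 = (M %/ 5)%N%:Z].
Proof.
case: (sqr_mod5 x) => [[z ->] | hx] e.
  have e' : 5 * (y ^+ 2 + 10 * z ^+ 2) = M%:Z by rewrite -e; ring.
  by split; [lia | lia | move=> _; exists z => //; lia].
by split; lia.
Qed.

Lemma form_mod25 (y z : int) M : y ^+ 2 + 10 * z ^+ 2 = M%:Z ->
  [/\ (M %% 5 != 2)%N, (M %% 5 != 3)%N
    & (5 %| M)%N -> exists w, 2 * z ^+ 2 + 5 * w ^+ 2 = (M %/ 5)%N%:Z].
Proof.
case: (sqr_mod5 y) => [[w ->] | hy] e.
  have e' : 5 * (2 * z ^+ 2 + 5 * w ^+ 2) = M%:Z by rewrite -e; ring.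
  by split; [lia | lia | move=> _; exists w; lia].
by split; lia.
Qed.

(** Dividing by 5 turns the form into y^2 + 10 z^2, and dividing by 5 again restores it. *)
Lemma form_descent alpha m :
  (exists x y : int, 2 * x ^+ 2 + 5 * y ^+ 2 = (25 ^ alpha * m)%N%:Z) ->
  exists x y : int, 2 * x ^+ 2 + 5 * y ^+ 2 = m%:Z.
Proof.
elim: alpha => [|a IH]; first by rewrite mul1n.
rewrite expnS -mulnA; move: (25 ^ a * m)%N IH => M IH [x [y e]]; apply: IH.
have [_ _ /(_ ltac:(lia))[z _ e1]] := form_mod5 e.
have [_ _ /(_ ltac:(lia))[w e2]] := form_mod25 e1.
by exists z, w; rewrite e2; lia.
Qed.

(** Classes 1 and 4 modulo 5 are not twice a square; in the other two cases m / 5 would be a square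
    modulo 5 in class 2 or 3. *)
Lemma form_unsolvable m (x y : int) :
  [|| m %% 5 == 1, m %% 5 == 4, m %% 25 == 10 | m %% 25 == 15]%N ->
  2 * x ^+ 2 + 5 * y ^+ 2 <> m%:Z.
Proof.
move=> hm e; have [h1 h4 h5] := form_mod5 e.
have [z _ e1] := h5 ltac:(lia); have [] := form_mod25 e1; lia.
Qed.

(** * The four progressions *)

Lemma p55_even alpha m N : (12 * N + 7 = 25 ^ alpha * m)%N -> ~~ odd N ->
  [|| m %% 5 == 1, m %% 5 == 4, m %% 25 == 10 | m %% 25 == 15]%N ->
  p55 N = 0 %[mod 2].
Proof.
move=> eN oN hm; rewrite mod0n modn2; apply/eqP; rewrite eqb0; apply/negP.
have [n en] : exists n, (N = 2 * n)%N by exists (N %/ 2)%N; lia.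
rewrite en => /odd_p55_even; have -> : (24 * n + 7 = 25 ^ alpha * m)%N by lia.
by case/form_descent => x [y]; apply: form_unsolvable.
Qed.

Local Open Scope nat_scope.

Theorem theorem3p7 (alpha n : nat) :
  [/\ p55 (2 * 5 ^ (2 * alpha + 1) * n + (31 * 5 ^ (2 * alpha) - 7) %/ 12)
        = 0 %[mod 2],
      p55 (2 * 5 ^ (2 * alpha + 1) * n + (79 * 5 ^ (2 * alpha) - 7) %/ 12)
        = 0 %[mod 2],
      p55 (2 * 5 ^ (2 * alpha + 2) * n + (83 * 5 ^ (2 * alpha + 1) - 7) %/ 12)
        = 0 %[mod 2]
    & p55 (2 * 5 ^ (2 * alpha + 2) * n + (107 * 5 ^ (2 * alpha + 1) - 7) %/ 12)
        = 0 %[mod 2]].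
Proof.
have e0 : 5 ^ (2 * alpha) = 25 ^ alpha by rewrite expnM.
rewrite !(expnD 5 (2 * alpha)) e0 expn1 -[5 ^ 2]/25.
(* This makes the divisions by 12 exact and the arguments of [p55] even. *)
have [q eq] : exists q, 25 ^ alpha = 24 * q + 1.
  elim: alpha {e0} => [|a [q eq]]; first by exists 0.
  by exists (25 * q + 1); rewrite expnS eq; lia.
split.
(* Each m is (12 N + 7) / 25^alpha; here 120 = 12 * 2 * 5, and below 600 = 12 * 2 * 25, 415 = 83 *
   5, 535 = 107 * 5. *)
- by apply: (@p55_even alpha (120 * n + 31)); rewrite ?eq; nia.
- by apply: (@p55_even alpha (120 * n + 79)); rewrite ?eq; nia.
- by apply: (@p55_even alpha (600 * n + 415)); rewrite ?eq; nia.
- by apply: (@p55_even alpha (600 * n + 535)); rewrite ?eq; nia.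
Qed.
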